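(* Let $\mathcal F=\emptyset$ (so all graphs are admissible), $\kappa=4$, and let $\gamma(H)=0$ for every graph $H$ of order 4 except $\gamma(C_4)=1$. Let $B=K_2$. Then the corresponding problem (the inducibility of $C_4$) is perfectly $B$-stable; moreover $\lim_{n\to\infty}\lambda(n,\mathcal G)=3/8$ and the unique maximiser of $\lambda(B(\mathbf a))$ over $\mathbf a\in\mathbb S_2$ is $(1/2,1/2)$.
   Context: All graphs are finite and simple; ''subgraph'' means induced subgraph. $P(F,G)$ is the number of $v(F)$-subsets of $V(G)$ inducing a copy of $F$, $p(F,G)=P(F,G)/\binom{v(G)}{v(F)}$. Admissible graphs are those containing no member of $\mathcal F$ as induced subgraph; $\mathcal G$ is the class of admissible graphs. With $\gamma$ defined on (isomorphism classes of) admissible graphs of order $\kappa$: $\Lambda(G)=\sum_H\gamma(H)P(H,G)$, $\lambda(G)=\Lambda(G)/\binom{v(G)}\kappa$, $\lambda(n,\mathcal G)=\max\{\lambda(G):G\in\mathcal G,v(G)=n\}$. For a graph $B$ on $[m]$ and disjoint sets $V_1,\dots,V_m$, the blow-up $B(V_1,\dots,V_m)$ has vertex set $\bigcup V_i$, with $u\in V_i,w\in V_j$ adjacent iff $ij\in E(B)$; $B()$ is the family of all blow-ups. $\mathbb S_m$ is the simplex of probability vectors in $\mathbb R^m$, and $\lambda(B(\mathbf a))=\lim_{n}\lambda(B(V_{1,n},\dots,V_{m,n}))$ with $|V_{i,n}|=a_in+O(1)$. $\delta_{\mathrm{edit}}(G,B())$ is the minimal number of adjacency changes turning $G$ (order $n$)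 into a blow-up of $B$, divided by $\binom n2$. Perfectly $B$-stable: there is $C>0$ with $\delta_{\mathrm{edit}}(G,B())\le C(\lambda(n,\mathcal G)-\lambda(G))$ for all admissible $G$ of order $n\ge C$. *)

(* Defs.v *)
From HB Require Import structures.
From mathcomp Require Import all_boot all_order all_algebra.
From mathcomp Require Import all_classical all_reals all_analysis.

Set Implicit Arguments.
Unset Strict Implicit.
Unset Printing Implicit Defensive.
Import Order.TTheory GRing.Theory Num.Theory numFieldNormedType.Exports.
Local Open Scope ring_scope.

(* A simple graph with vertex set T is a set of 2-element subsets of T. *)
Record sgraph (T : finType) := SGraph {
  edges : {set {set T}};
  edges_card2 : [forall e in edges, #|e| == 2%N] }.

HB.instance Definition _ (T : finType) := [isSub for @edges T].
HB.instance Definition _ (T : finType) := [Finite of sgraph T by <:].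

Definition adj (T : finType) (G : sgraph T) (x y : T) : bool :=
  [set x; y]%SET \in edges G.

Definition rel_edges (T : finType) (r : rel T) : {set {set T}} :=
  [set e | [exists x, exists y, [&& x != y, r x y & e == [set x; y]]]]%SET.

Lemma rel_edges_card2 (T : finType) (r : rel T) :
  [forall e in rel_edges r, #|e| == 2%N].
Proof.
apply/forallP => e; apply/implyP; rewrite inE.
by case/existsP => x /existsP[y /and3P[xy _ /eqP->]]; rewrite cards2 xy.
Qed.

(* x and y are adjacent iff x != y and r holds in at least one direction. *)
Definition graph_of_rel (T : finType) (r : rel T) : sgraph T :=
  SGraph (rel_edges_card2 r).

Definition complete_graph (m : nat) : sgraph 'I_m :=
  graph_of_rel (fun _ _ => true).

Definition cycle_graph (m : nat) : sgraph 'I_m :=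
  graph_of_rel (fun i j : 'I_m => nat_of_ord j == (i.+1 %% m)%N).

(* The subgraph of G induced by S is isomorphic to H. *)
Definition induces_copy (U T : finType) (H : sgraph U) (G : sgraph T)
    (S : {set T}) : bool :=
  [exists f : {ffun U -> T},
    [&& injectiveb f, f @: [set: U]%SET == S
      & [forall x, forall y, adj H x y == adj G (f x) (f y)]]].

Definition isomorphic (U T : finType) (H : sgraph U) (G : sgraph T) : bool :=
  induces_copy H G [set: T]%SET.

Lemma isomorphic_refl (T : finType) (G : sgraph T) : isomorphic G G.
Proof.
apply/existsP; exists [ffun x => x]; apply/and3P; split.
- by apply/injectiveP => x y; rewrite !ffunE.
- apply/eqP/setP => y; rewrite finset.in_setT; apply/imsetP.
  by exists y; rewrite ?finset.in_setT ?ffunE.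
- by apply/forallP => x; apply/forallP => y; rewrite !ffunE.
Qed.

Lemma isomorphic_trans (T U W : finType) (G : sgraph T) (H : sgraph U)
    (K : sgraph W) : isomorphic G H -> isomorphic H K -> isomorphic G K.
Proof.
case/existsP => f /and3P[/injectiveP fi /eqP fs /forallP fa].
case/existsP => g /and3P[/injectiveP gi /eqP gs /forallP ga].
apply/existsP; exists [ffun x => g (f x)]; apply/and3P; split.
- by apply/injectiveP => x y; rewrite !ffunE => /gi/fi.
- apply/eqP/setP => z; rewrite finset.in_setT.
  have /imsetP[y _ ->] : z \in g @: [set: U]%SET by rewrite gs finset.in_setT.
  have /imsetP[x _ ->] : y \in f @: [set: T]%SET by rewrite fs finset.in_setT.
  by apply/imsetP; exists x; rewrite ?finset.in_setT ?ffunE.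
- apply/forallP => x; apply/forallP => y; rewrite !ffunE.
  by rewrite (eqP (forallP (fa x) y)); exact: (forallP (ga _)).
Qed.

Lemma isomorphic_sym (T U : finType) (G : sgraph T) (H : sgraph U) :
  isomorphic G H = isomorphic H G.
Proof.
suff imp (T' U' : finType) (G' : sgraph T') (H' : sgraph U') :
    isomorphic G' H' -> isomorphic H' G'.
  by apply/idP/idP; exact: imp.
case/existsP => f /and3P[/injectiveP fi /eqP fs /forallP fa].
have fP y : exists x, f x == y.
  have /imsetP[x _ ->] : y \in f @: [set: T']%SET by rewrite fs finset.in_setT.
  by exists x.
pose g := [ffun y => xchoose (fP y)].
have fg y : f (g y) = y by rewrite ffunE; apply/eqP; exact: (xchooseP (fP y)).
apply/existsP; exists g; apply/and3P; split.
- by apply/injectiveP => x y e; rewrite -(fg x) e fg.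
- apply/eqP/setP => x; rewrite finset.in_setT; apply/imsetP.
  exists (f x); rewrite ?finset.in_setT //; by apply: fi; rewrite fg.
- apply/forallP => x; apply/forallP => y.
  by rewrite (eqP (forallP (fa (g x)) (g y))) !fg.
Qed.

(* P(H, G) *)
Definition copies (U T : finType) (H : sgraph U) (G : sgraph T) : nat :=
  #|[set S : {set T} | induces_copy H G S]%SET|.

Definition family := forall k : nat, sgraph 'I_k -> Prop.

Definition admissible (F : family) (T : finType) (G : sgraph T) : bool :=
  `[< forall (k : nat) (H : sgraph 'I_k), F k H -> copies H G = 0%N >].

(* Being a function of the isomorphism class is recorded by the last field. *)
Record problem (R : realType) := Problem {
  forbidden : family;
  kappa : nat;
  gamma : sgraph 'I_kappa -> R;
  gamma_iso : forall H H', isomorphic H H' -> gamma H = gamma H' }.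

(* One representative of each isomorphism class of admissible graphs of
   order k. *)
Definition iso_reps (F : family) (k : nat) : {set sgraph 'I_k} :=
  let D := [set H : sgraph 'I_k | admissible F H]%SET in
  transversal (equivalence_partition (@isomorphic 'I_k 'I_k) D) D.

Section Problem.
Variables (R : realType) (Q : problem R).

Definition Lambda (T : finType) (G : sgraph T) : R :=
  \sum_(H in iso_reps (forbidden Q) (kappa Q)) gamma H * (copies H G)%:R.

Definition lambda (T : finType) (G : sgraph T) : R :=
  Lambda G / 'C(#|T|, kappa Q)%:R.

(* lambda(n, G); the value 0 is used only if no graph of order n is
   admissible. *)
Definition lambda_max (n : nat) : R :=
  if [pick G : sgraph 'I_n | admissible (forbidden Q) G] is Some G0
  then lambda [arg max_(G > G0 | admissible (forbidden Q) G) lambda G]%O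
  else 0.

End Problem.

(* The blow-up of B with parts V_i = f @^-1 i, which may be empty. *)
Definition blowup (m : nat) (B : sgraph 'I_m) (T : finType) (f : T -> 'I_m) :
  sgraph T := graph_of_rel (fun x y => adj B (f x) (f y)).

Definition is_blowup (m : nat) (B : sgraph 'I_m) (T : finType) (G : sgraph T) :
  bool := [exists f : {ffun T -> 'I_m}, G == blowup B f].

(* The default 'C(#|T|, 2) bounds every term, so it does not affect the minimum
   (there is no blow-up with vertex set T only if m = 0 < #|T|). *)
Definition edit_number (m : nat) (B : sgraph 'I_m) (T : finType)
    (G : sgraph T) : nat :=
  \big[minn/'C(#|T|, 2)]_(G' : sgraph T | is_blowup B G')
     #|((edges G :\: edges G') :|: (edges G' :\: edges G))%SET|.

Definition edit_distance (R : realType) (m : nat) (B : sgraph 'I_m)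
    (T : finType) (G : sgraph T) : R :=
  (edit_number B G)%:R / 'C(#|T|, 2)%:R.

Definition perfectly_stable (R : realType) (Q : problem R) (m : nat)
    (B : sgraph 'I_m) : Prop :=
  exists C : R, 0 < C /\
    forall (n : nat) (G : sgraph 'I_n),
      C <= n%:R -> admissible (forbidden Q) G ->
      edit_distance R B G <= C * (lambda_max Q n - lambda Q G).

Definition simplex (R : realType) (m : nat) (a : 'rV[R]_m) : Prop :=
  (forall i, 0 <= a 0 i) /\ \sum_i a 0 i = 1.

(* The blow-up of B whose i-th part has s i vertices. *)
Definition blowup_sizes (m : nat) (B : sgraph 'I_m) (s : 'I_m -> nat) :
  sgraph {i : 'I_m & 'I_(s i)} := blowup B (fun x => tag x).

Definition is_lambda_blowup (R : realType) (Q : problem R) (m : nat)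
    (B : sgraph 'I_m) (a : 'rV[R]_m) (l : R) : Prop :=
  forall s : nat -> 'I_m -> nat,
    (exists K : R, forall n i, `|(s n i)%:R - a 0 i * n%:R| <= K) ->
    (lambda Q (blowup_sizes B (s n)) @[n --> \oo] --> l)%classic.

(* lambda(B(a)); meaningful when is_lambda_blowup Q B a holds of some l. *)
Definition lambda_blowup (R : realType) (Q : problem R) (m : nat)
    (B : sgraph 'I_m) (a : 'rV[R]_m) : R :=
  get (is_lambda_blowup Q B a).

Definition is_maximiser (R : realType) (Q : problem R) (m : nat)
    (B : sgraph 'I_m) (a : 'rV[R]_m) : Prop :=
  simplex a /\
  forall b, simplex b -> lambda_blowup Q B b <= lambda_blowup Q B a.

Definition gammaC4 (R : realType) (H : sgraph 'I_4) : R :=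
  if isomorphic H (cycle_graph 4) then 1 else 0.

Lemma gammaC4_iso (R : realType) (H H' : sgraph 'I_4) :
  isomorphic H H' -> gammaC4 R H = gammaC4 R H'.
Proof.
move=> HH'; rewrite /gammaC4; congr (if _ then _ else _).
by apply/idP/idP; apply: isomorphic_trans; rewrite // isomorphic_sym.
Qed.

Definition C4_inducibility (R : realType) : problem R :=
  @Problem R (fun _ _ => False) 4 (@gammaC4 R) (@gammaC4_iso R).

(* Main.v *)
(* Sum over ordered adjacent pairs (u, v): with A the neighbours of u only, B
   those of v only, and R the vertices adjacent to both or to neither, the
   4-cycles through the edge uv are the edges between A and B, so 8 P(C4, G) is
   at most the sum of |A||B| minus the number of non-adjacent pairs of A x B.
   Let M be the number of 4-cycles in the balanced complete bipartite graph, put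
   K = 4 M / n, and write d(u) for the degree of u.  Then
   |A||B| + n |R| / 16 <= K (1/d(u) + 1/d(v)) for n >= 12, and the right-hand
   sides sum to at most 2 K n = 8 M: this gives both the extremal number and a
   bound on the sum of n |R| plus the missing pairs by the deficit M - P(C4, G).
   On the other hand, colouring vertices by adjacency to u makes G complete
   bipartite at the cost of the edges inside N(u) and N(v), the missing pairs and
   2 n |R|; the number of edges inside N(u) is itself a sum of codegrees, hence of
   |R|'s.  Averaging over the edges bounds n^2 times the edit number by the
   deficit. *)
Require Import Defs.
From mathcomp Require Import all_boot all_order all_algebra.
From mathcomp Require Import all_classical all_reals all_analysis.
From mathcomp Require Import zify ring lra.

Set Implicit Arguments.
Unset Strict Implicit.
Unset Printing Implicit Defensive.
Import Order.TTheory GRing.Theory Num.Theory numFieldNormedType.Exports.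
Local Open Scope ring_scope.

(** * Adjacency, isomorphism invariance, and [Lambda] as a count of 4-cycles *)

Lemma set2_eq (T : finType) (x y a b : T) :
  [set x; y]%SET = [set a; b]%SET -> (x = a /\ y = b) \/ (x = b /\ y = a).
Proof.
move=> e.
have /set2P[xa|xb] : x \in [set a; b]%SET by rewrite -e set21.
  have /set2P[bx|by_] : b \in [set x; y]%SET by rewrite e set22.
    have /set2P[ya|yb] : y \in [set a; b]%SET by rewrite -e set22.
      by left; rewrite bx xa ya.
    by left.
  by left.
have /set2P[ax|ay] : a \in [set x; y]%SET by rewrite e set21.
  have /set2P[ya|yb] : y \in [set a; b]%SET by rewrite -e set22.
    by right.
  by right; rewrite ax xb yb.
by right.
Qed.

Lemma adjC (T : finType) (G : sgraph T) x y : adj G x y = adj G y x.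
Proof. by rewrite /adj finset.setUC. Qed.

Lemma adjxx (T : finType) (G : sgraph T) x : adj G x x = false.
Proof.
apply/negP => h; have /forallP/(_ [set x; x]%SET) := edges_card2 G.
by move: h; rewrite /adj => ->; rewrite cards2 eqxx.
Qed.

Lemma adj_neq (T : finType) (G : sgraph T) x y : adj G x y -> x != y.
Proof. by case: eqVneq => // ->; rewrite adjxx. Qed.

Lemma edge_set2 (T : finType) (G : sgraph T) e :
  e \in edges G -> exists x y, x != y /\ e = [set x; y]%SET.
Proof.
move=> eG; apply/cards2P.
by have /forallP/(_ e) := edges_card2 G; rewrite eG.
Qed.

Lemma adj_graph_of_rel (T : finType) (r : rel T) x y :
  adj (graph_of_rel r) x y = (x != y) && (r x y || r y x).
Proof.
rewrite /adj /= inE; apply/existsP/idP => [[a /existsP[b]]|].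
  case/and3P=> ab rab /eqP/set2_eq[[-> ->]|[-> ->]]; first by rewrite ab rab.
  by rewrite eq_sym ab rab orbT.
case/andP=> xy /orP[rxy|ryx]; [exists x|exists y]; apply/existsP.
  by exists y; rewrite xy rxy eqxx.
by exists x; rewrite eq_sym xy ryx finset.setUC eqxx.
Qed.

(** Phrased in the additive group Z/4, so that translations and reflections visibly preserve
    adjacency. *)
Lemma adj_cycle4 (i j : 'I_4) :
  adj (cycle_graph 4) i j = (j == i + 1) || (i == j + 1).
Proof.
rewrite adj_graph_of_rel.
by case: i j => [[|[|[|[|i]]]] hi] [[|[|[|[|j]]]] hj].
Qed.

Lemma adj_blowup_K2 (T : finType) (f : T -> 'I_2) x y :
  adj (blowup (complete_graph 2) f) x y = (f x != f y).
Proof.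
rewrite /blowup /complete_graph !adj_graph_of_rel /= !andbT.
by rewrite [f y == _]eq_sym orbb; case: (eqVneq x y) => // ->; rewrite eqxx.
Qed.

Lemma induces_copy_iso (U W T : finType) (H : sgraph U) (K : sgraph W)
    (G : sgraph T) (S : {set T}) :
  isomorphic H K -> induces_copy K G S -> induces_copy H G S.
Proof.
case/existsP => f /and3P[/injectiveP fi /eqP fs /forallP fa].
case/existsP => g /and3P[/injectiveP gi /eqP gs /forallP ga].
apply/existsP; exists [ffun x => g (f x)]; apply/and3P; split.
- by apply/injectiveP => x y; rewrite !ffunE => /gi/fi.
- rewrite -gs -fs -imset_comp; apply/eqP/eq_imset => x; exact: ffunE.
- apply/forallP => x; apply/forallP => y; rewrite !ffunE.
  by rewrite (eqP (forallP (fa x) y)); exact: (forallP (ga _)).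
Qed.

Lemma copies_iso (U W T : finType) (H : sgraph U) (K : sgraph W)
    (G : sgraph T) : isomorphic H K -> copies H G = copies K G.
Proof.
move=> HK; apply: eq_card => S; rewrite !inE; apply/idP/idP.
  by apply: induces_copy_iso; rewrite isomorphic_sym.
exact: induces_copy_iso.
Qed.

Lemma admissible_C4 (R : realType) (T : finType) (G : sgraph T) :
  admissible (forbidden (C4_inducibility R)) G.
Proof. exact/asboolP. Qed.

(** Exactly one representative, [H0], lies in the block of the 4-cycle. All others have [gamma]
    zero, and [copies] is invariant under isomorphism, so [H0] may be traded for the cycle. *)
Lemma Lambda_C4 (R : realType) (T : finType) (G : sgraph T) :
  Lambda (C4_inducibility R) G = (copies (cycle_graph 4) G)%:R.
Proof.
rewrite /Lambda /iso_reps /=.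
set D := [set H | _]%SET; set P := equivalence_partition _ _.
set X := transversal P D.
have DT H : H \in D by rewrite inE admissible_C4.
have isoE : {in D & &, equivalence_rel (@isomorphic 'I_4 'I_4)}.
  move=> x y z _ _ _; split; first exact: isomorphic_refl.
  move=> xy; apply/idP/idP; apply: isomorphic_trans => //.
  by rewrite isomorphic_sym.
have Ppart : finset.partition P D := equivalence_partitionP isoE.
have trX : is_transversal X P D := transversalP Ppart.
have cov H : H \in finset.cover P by rewrite (finset.cover_partition Ppart).
set C := cycle_graph 4.
pose H0 := transversal_repr C X (finset.pblock P C).
have pC : finset.pblock P C \in P by rewrite finset.pblock_mem.
have H0X : H0 \in X by exact: (repr_mem_transversal trX).
have pbE H K : (H \in finset.pblock P K) = isomorphic K H.
  by rewrite finset.pblock_equivalence_partition.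
have H0C : isomorphic C H0 by rewrite -pbE; exact: (repr_mem_pblock trX).
rewrite (bigD1 H0) //= big1 => [|H /andP[HX HH0]].
  by rewrite addr0 /gammaC4 isomorphic_sym H0C mul1r (copies_iso _ H0C).
rewrite /gammaC4; case: ifP => [HC|]; last by rewrite mul0r.
case/eqP: HH0; apply: (finset.pblock_inj trX) => //.
apply/eqP; rewrite finset.eq_pblock ?(finset.partition_trivIset Ppart) // pbE.
exact: isomorphic_trans HC H0C.
Qed.

(** * Counting induced 4-cycles by labellings and by edges *)

(* The 8 labellings of a 4-cycle inducing a given copy are its compositions
   with the maps [i |-> k + i] and [i |-> k - i] of Z/4. *)
Lemma copies_C4_embeddings (T : finType) (G : sgraph T) :
  (copies (cycle_graph 4) G * 8 <=
   #|[set f : {ffun 'I_4 -> T} | injectiveb f &&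
      [forall i, forall j, adj (cycle_graph 4) i j == adj G (f i) (f j)]]%SET|)%N.
Proof.
set E := [set f | _]%SET; set C := cycle_graph 4.
pose im (f : {ffun 'I_4 -> T}) := (f @: [set: 'I_4])%SET.
(* Group the labellings by image; it suffices to find 8 over each [S] inducing a copy. *)
rewrite -[leqRHS]sum1_card (partition_big im predT) //= /copies.
rewrite -sum_nat_const; apply: leq_trans (_ : (_ <= \sum_(S | S \in
  [set S | induces_copy C G S]%SET) \sum_(f in E | im f == S) 1)%N) _; last first.
  by rewrite [leqRHS](bigID (mem [set S | induces_copy C G S]%SET)) /= leq_addr.
apply: leq_sum => S; rewrite inE => /existsP[f /and3P[/injectiveP fi /eqP fS]].
move=> /forallP fa.
pose s (p : bool * 'I_4) (i : 'I_4) : 'I_4 := p.2 + (if p.1 then i else - i).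
have si p : injective (s p).
  by case: p => -[] k i j /addrI //; exact: oppr_inj.
pose F p := [ffun i => f (s p i)].
have Finj : injective F.
  (* The value at 0 reveals the shift; the value at 1 then reveals the sign, since 1 and -1 differ
     in Z/4. *)
  move=> [b k] [c l] /ffunP e; have := e 0; have := e 1.
  rewrite !ffunE /s /= => /fi e1 /fi; rewrite !oppr0 !if_same !addr0 => kl.
  by move: e1; rewrite kl => /addrI; case: b c {e} => -[].
have -> : 8%N = #|(F @: [set: bool * 'I_4])%SET|.
  by rewrite card_imset // cardsT card_prod card_bool card_ord.
rewrite sum1dep_card; apply/subset_leq_card/fintype.subsetP => g /imsetP[p _ ->{g}].
rewrite !inE; apply/andP; split.
  apply/andP; split; first by apply/injectiveP => i j; rewrite !ffunE => /fi/si.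
  apply/forallP => i; apply/forallP => j; rewrite !ffunE.
  rewrite -(eqP (forallP (fa (s p i)) (s p j))) !adj_cycle4.
  case: p => -[] k; rewrite /s /= -!addrA ?(inj_eq (addrI _)) //.
  have oppE (a b : 'I_4) : (- a == - b + 1) = (b == a + 1).
    by case: a b => [[|[|[|[|a]]]] ha] [[|[|[|[|b]]]] hb].
  by rewrite !oppE orbC.
apply/eqP; rewrite -fS /im; apply/setP => x; apply/imsetP/imsetP => -[i _ ->].
  by rewrite ffunE; exists (s p i).
have [s' ss' s's] := injF_bij (si p).
by exists (s' i); rewrite // ffunE s's.
Qed.

(** For adjacent [u], [v], each member completes them to the induced 4-cycle [u], [v], [p.2], [p.1].
    Since no vertex is adjacent to itself, non-adjacency to [v] would not exclude [p.1 = v];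
    likewise for [u] and [p.2]. *)
Definition crossing (T : finType) (G : sgraph T) (u v : T) : {set T * T} :=
  [set p | [&& adj G u p.1, ~~ adj G v p.1, p.1 != v, adj G v p.2,
               ~~ adj G u p.2, p.2 != u & adj G p.1 p.2]]%SET.

(** A labelled cycle [f] is sent to the oriented edge [(f 0, f 1)] together with the opposite pair
    [(f 3, f 2)]; this is injective. *)
Lemma copies_C4_crossing (T : finType) (G : sgraph T) :
  (copies (cycle_graph 4) G * 8 <=
   \sum_(p : T * T | adj G p.1 p.2) #|crossing G p.1 p.2|)%N.
Proof.
apply: leq_trans (copies_C4_embeddings G) _.
set E := [set f | _]%SET.
under eq_bigr do rewrite -sum1_card.
rewrite (pair_big_dep (fun p : T * T => adj G p.1 p.2)
  (fun p q => q \in crossing G p.1 p.2)) /= sum1dep_card.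
pose F (f : {ffun 'I_4 -> T}) := ((f 0, f 1), (f 3, f 2)).
have Finj : injective F.
  move=> f g [e0 e1 e3 e2]; apply/ffunP => i.
  have : i \in [:: 0; 1; 2; 3] by case: i => [[|[|[|[|i]]]] hi].
  by rewrite !inE => /or4P[] /eqP->.
rewrite -(card_imset _ Finj); apply/subset_leq_card/fintype.subsetP => q /imsetP[f].
rewrite /E finset.in_set => /andP[/injectiveP fi /forallP fa] ->.
have fA i j : adj G (f i) (f j) = adj (cycle_graph 4) i j.
  by rewrite (eqP (forallP (fa i) j)).
by rewrite !inE /= !fA !(inj_eq fi) !adj_cycle4.
Qed.

(** * Induced 4-cycles in complete bipartite graphs *)

Lemma induces_C4_K2 (T : finType) (f : T -> 'I_2) (S : {set T}) :
  induces_copy (cycle_graph 4) (blowup (complete_graph 2) f) S =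
  [forall c : 'I_2, #|S :&: [set x | f x == c]|%SET == 2%N].
Proof.
apply/existsP/forallP => [[g /and3P[/injectiveP gi /eqP <- /forallP ga]] c | h].
  have gA i j : (f (g i) != f (g j)) = (j == i + 1) || (i == j + 1).
    by rewrite -adj_cycle4 -(adj_blowup_K2 f) (eqP (forallP (ga i) j)).
  have -> : (g @: [set: 'I_4] :&: [set x | f x == c])%SET =
            (g @: [set i | f (g i) == c])%SET.
    apply/setP => x; rewrite !inE; apply/andP/imsetP.
      by move=> [/imsetP[i _ ->] fc]; exists i; rewrite ?inE.
    by move=> [i]; rewrite inE => fc ->; rewrite imset_f.
  rewrite card_imset // -sum1dep_card big_mkcond !big_ord_recl big_ord0 /=.
  set i1 : 'I_4 := lift ord0 (ord0 : 'I_3).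
  set i2 : 'I_4 := lift ord0 (lift ord0 (ord0 : 'I_2)).
  set i3 : 'I_4 := lift ord0 (lift ord0 (lift ord0 (ord0 : 'I_1))).
  (* The colours at 0 and 1 differ, while those at 0, 2 and at 1, 3 agree. This forces two vertices
     of each colour; the rest is enumeration. *)
  have := gA ord0 i1; have := gA ord0 i2; have := gA i1 i3.
  case: (f (g ord0)) (f (g i1)) (f (g i2)) (f (g i3)) c
    => [[|[|?]] ?] [[|[|?]] ?] [[|[|?]] ?] [[|[|?]] ?] [[|[|?]] ?] //.
have /cards2P[a [b [ab Sab]]] := h 0; have /cards2P[c [d [cd Scd]]] := h 1.
have fab x : (x \in [set a; b]%SET) = (x \in S) && (f x == 0).
  by rewrite -Sab !inE.
have fcd x : (x \in [set c; d]%SET) = (x \in S) && (f x == 1).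
  by rewrite -Scd !inE.
have /andP[aS /eqP fa] : (a \in S) && (f a == 0) by rewrite -fab set21.
have /andP[bS /eqP fb] : (b \in S) && (f b == 0) by rewrite -fab set22.
have /andP[cS /eqP fc] : (c \in S) && (f c == 1) by rewrite -fcd set21.
have /andP[dS /eqP fd] : (d \in S) && (f d == 1) by rewrite -fcd set22.
(* Alternating the colours makes consecutive vertices adjacent and opposite ones non-adjacent. *)
pose s := [tuple a; c; b; d].
exists [ffun i => tnth s i]; apply/and3P; split.
- have us : uniq s.
    have ne x y : f x = 0 -> f y = 1 -> x != y.
      by move=> fx fy; apply/eqP => xy; move: fy; rewrite -xy fx.
    by rewrite /= !inE !negb_or ab cd [c == b]eq_sym !ne.
  by apply/injectiveP => i j; rewrite !ffunE => /(tuple_uniqP _ us).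
- apply/eqP/setP => x; apply/imsetP/idP => [[i _ ->]|xS].
    by rewrite ffunE; case: i => [[|[|[|[|i]]]] hi].
  have : x \in s.
    have : (f x == 0) || (f x == 1) by case: (f x) => [[|[|?]] ?].
    case/orP => fx.
      have : x \in [set a; b]%SET by rewrite fab xS.
      by rewrite !inE => /orP[]->; rewrite ?orbT.
    have : x \in [set c; d]%SET by rewrite fcd xS.
    by rewrite !inE => /orP[]->; rewrite ?orbT.
  by case/tnthP => i ->; exists i; rewrite // ffunE.
- apply/forallP => i; apply/forallP => j; rewrite adj_cycle4 adj_blowup_K2 !ffunE.
  by case: i j => [[|[|[|[|i]]]] hi] [[|[|[|[|j]]]] hj] //;
    rewrite !(tnth_nth a) /= ?fa ?fb ?fc ?fd.
Qed.

(** Copies correspond to pairs of 2-subsets, one in each part: [S] is the union of its traces on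
    [V0] and [V1]. *)
Lemma copies_C4_K2 (T : finType) (f : T -> 'I_2) :
  copies (cycle_graph 4) (blowup (complete_graph 2) f) =
  (\prod_(c : 'I_2) 'C(#|[set x | f x == c]%SET|, 2))%N.
Proof.
rewrite big_ord_recl big_ord1.
have -> : lift ord0 ord0 = 1 :> 'I_2 by exact: val_inj.
set V0 := [set x | f x == _]%SET; set V1 := [set x | f x == _]%SET.
rewrite -!cards_draws -cardsX.
have VS (A B : {set T}) : A \subset V0 -> B \subset V1 ->
    ((A :|: B) :&: V0 = A)%SET /\ ((A :|: B) :&: V1 = B)%SET.
  move=> AV BV.
  have V01 : (V0 :&: V1 = finset.set0)%SET.
    by apply/setP => x; rewrite !inE; case: (f x) => [[|[|?]] ?].
  rewrite !finset.setIUl (finset.setIidPl AV) (finset.setIidPl BV); split.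
    apply/finset.setUidPl/(fintype.subset_trans (finset.setSI _ BV)).
    by rewrite finset.setIC V01 finset.sub0set.
  apply/finset.setUidPr/(fintype.subset_trans (finset.setSI _ AV)).
  by rewrite V01 finset.sub0set.
rewrite -(card_in_imset (f := fun p : {set T} * {set T} => (p.1 :|: p.2)%SET)).
  apply: eq_card => S; rewrite inE induces_C4_K2; apply/forallP/imsetP.
    move=> h; exists ((S :&: V0)%SET, (S :&: V1)%SET).
      by rewrite !inE /= !finset.subsetIr (eqP (h 0)) (eqP (h 1)).
    rewrite /= -finset.setIUr; apply/esym/finset.setIidPl/fintype.subsetP => x _.
    by rewrite !inE; case: (f x) => [[|[|?]] ?].
  move=> [[A B]]; rewrite !inE /= => /andP[/andP[AV cA] /andP[BV cB]] ->.
  have [e0 e1] := VS A B AV BV.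
  move=> [[|[|?]] hc] //.
    by rewrite [Ordinal hc](_ : _ = 0 :> 'I_2) ?e0 //; exact: val_inj.
  by rewrite [Ordinal hc](_ : _ = 1 :> 'I_2) ?e1 //; exact: val_inj.
move=> [A B] [A' B']; rewrite !inE /= => /andP[/andP[AV _] /andP[BV _]].
move=> /andP[/andP[AV' _] /andP[BV' _]] e.
have [e0 e1] := VS A B AV BV; have [e0' e1'] := VS A' B' AV' BV'.
by congr (_, _); [rewrite -e0 e|rewrite -e1 e].
Qed.

(** * The extremal number and the inequality at a single edge *)

Definition maxC4 (n : nat) : nat := ('C(n./2, 2) * 'C(uphalf n, 2))%N.

Lemma bin2_double x : ('C(x, 2) * 2 = x * x.-1)%N.
Proof. by have := bin_ffact x 2; rewrite ffactnS ffactn1. Qed.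

Lemma natr_bin2 (R : realFieldType) (x : nat) :
  'C(x, 2)%:R = x%:R * (x%:R - 1) / 2 :> R.
Proof.
case: x => [|x]; first by rewrite bin0n !mul0r.
apply: (@mulIf _ 2); first by rewrite pnatr_eq0.
by rewrite -[LHS]natrM bin2_double natrM -natr1 /=; field.
Qed.

(** Four times the product is [x * y] times [x.-1 * y.-1], and each of these grows as the two sizes
    approach each other. *)
Lemma bin2M_le_maxC4 x y : ('C(x, 2) * 'C(y, 2) <= maxC4 (x + y))%N.
Proof.
wlog xy : x y / (x <= y)%N => [h|].
  case: (leqP x y) => [/h//|/ltnW/h]; by rewrite addnC mulnC.
rewrite -(@leq_pmul2r (2 * 2)) // /maxC4 mulnACA [leqRHS]mulnACA !bin2_double.
set a := (x + y)./2; set b := uphalf (x + y).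
have -> : (x * x.-1 * (y * y.-1) = (x * y) * (x.-1 * y.-1))%N by lia.
have -> : (a * a.-1 * (b * b.-1) = (a * b) * (a.-1 * b.-1))%N by lia.
(* [d] vertices move from the larger part to the smaller one to balance the sizes. *)
have [d [ax b_y]] : exists d, (a = x + d /\ y = b + d)%N.
  by exists (a - x)%N; rewrite /a /b; lia.
have ab : (a <= b)%N by rewrite /a /b; lia.
clearbody a b; subst a y.
case: x xy ab => [|x] xy ab; first by rewrite !mul0n.
have [c ->] : exists c, (b = x.+1 + d + c)%N by exists (b - (x.+1 + d))%N; lia.
by apply: leq_mul; rewrite ?addSn /=; nia.
Qed.

Lemma maxC4E n : exists k, (n = k + k /\ maxC4 n = 'C(k, 2) * 'C(k, 2))%N \/
  (n = k + k + 1 /\ maxC4 n = 'C(k, 2) * 'C(k + 1, 2))%N.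
Proof.
exists n./2; rewrite /maxC4 uphalf_half.
have := odd_double_half n; rewrite -addnn; move: (n./2) => k.
by case: (odd n) => <-; [right|left]; rewrite ?add0n // ![(true + _)%N]add1n !addn1.
Qed.

(** The right-hand side equals n^2 (n-2)^2 for even n and (n-1)^2 (n-3) (n+1) for odd n; both begin
    with n^4 - 4 n^3, and the remainder is nonnegative up to a constant that the n^2 term
    absorbs. *)
Lemma maxC4_lower (R : realFieldType) (n : nat) :
  n%:R ^+ 3 * (n%:R - 4) <= 64 * (maxC4 n)%:R :> R.
Proof.
have [k [][-> ->]] := maxC4E n; rewrite natrM !natr_bin2 !natrD.
  have : 0 <= (k%:R : R) * k%:R by rewrite -natrM ler0n.
  by move: (k%:R : R) => h h0; rewrite -subr_ge0; lra.
have : 0 <= (k%:R : R) * k%:R by rewrite -natrM ler0n.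
have : 0 <= (k%:R : R) by rewrite ler0n.
by move: (k%:R : R) => h h0 h1; lra.
Qed.

(* AM-GM on [a * (a + 1 + t)] and [b * (b + 1 + t)]. *)
Lemma edge_bound_real (R : realFieldType) (n a b t q M : R) :
  0 <= a -> 0 <= b -> 0 <= t -> 0 <= q -> n = a + b + t + q + 2 ->
  1 <= t + q -> 12 <= n -> n ^+ 3 * (n - 4) <= 64 * M ->
  n * (a * b + n * (t + q) / 16) * ((a + 1 + t) * (b + 1 + t)) <=
  4 * M * (a + b + 2 + 2 * t).
Proof.
move=> a0 b0 t0 q0 en r1 n12 hM.
set x := a + 1 + t; set y := b + 1 + t; set s := a + b + 2 + 2 * t.
set r := t + q; set p := a + b.
have hxy : 4 * (x * y) <= s ^+ 2.
  have -> : s ^+ 2 = 4 * (x * y) + (x - y) ^+ 2 by rewrite /s /x /y; ring.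
  by rewrite lerDl sqr_ge0.
have hab : 4 * (a * b) <= p ^+ 2.
  have -> : p ^+ 2 = 4 * (a * b) + (a - b) ^+ 2 by rewrite /p; ring.
  by rewrite lerDl sqr_ge0.
have n0 : 0 <= n by lra.
have s0 : 0 <= s by rewrite /s; lra.
have p0 : 0 <= p by rewrite /p; lra.
have r0 : 0 <= r by rewrite /r; lra.
have ep : p = n - 2 - r by rewrite /p /r; lra.
have sr : s <= n + r by rewrite /s /r; lra.
(* After AM-GM only a polynomial inequality in [n] and [r] remains, because
   [s = n + t - q <= n + r]. *)
have key : (p ^+ 2 + n * r / 4) * s <= n ^+ 2 * (n - 4).
  apply: (@le_trans _ _ ((p ^+ 2 + n * r / 4) * (n + r))).
    by apply: ler_wpM2l => //; nra.
  have rn : r <= n - 2 by lra.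
  have h1 : (n - 2 - r) ^+ 2 * (n + r) <= (n - 2 - r) * (n ^+ 2 - 2 * n).
    rewrite expr2 -mulrA; apply: ler_wpM2l; first lra.
    by have : 0 <= r * r := mulr_ge0 r0 r0; lra.
  have h2 : n * r * (n + r) <= n * r * (2 * n).
    by apply: ler_wpM2l; [exact: mulr_ge0|lra].
  (* By [h1] and [h2] it remains to see 4 n + 2 n r <= n^2 r / 2; [12 <= n] and [1 <= r] give this
     with equality possible. *)
  have h3 : 12 * (n * r) <= n * (n * r).
    by apply: ler_wpM2r => //; exact: mulr_ge0.
  have h4 : n * 1 <= n * r by exact: ler_wpM2l.
  rewrite ep mulrDl; lra.
have key2 : n * (p ^+ 2 + n * r / 4) * s <= 64 * M.
  apply: le_trans hM; rewrite -mulrA.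
  have -> : n ^+ 3 * (n - 4) = n * (n ^+ 2 * (n - 4)) by ring.
  exact: ler_wpM2l.
have nr0 : 0 <= n * r := mulr_ge0 n0 r0.
apply: (@le_trans _ _ (n * ((p ^+ 2 + n * r / 4) / 4) * (s ^+ 2 / 4))).
  apply: ler_pM.
  - by apply: mulr_ge0 => //; have := mulr_ge0 a0 b0; lra.
  - by apply: mulr_ge0; rewrite /x /y; lra.
  - by apply: ler_wpM2l => //; lra.
  - by lra.
have -> : n * ((p ^+ 2 + n * r / 4) / 4) * (s ^+ 2 / 4) =
  n * (p ^+ 2 + n * r / 4) * s * s / 16 by field.
have := ler_wpM2r s0 key2; lra.
Qed.

(** Here [a], [b] count the private neighbours of the two ends, [t] the common ones and [q] the
    vertices adjacent to neither, so [a + 1 + t] and [b + 1 + t] are the degrees. If [t + q > 0],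
    the slack absorbs the loss in [maxC4_lower]. If [t + q = 0], the bound can be tight, and the
    exact [bin2M_le_maxC4] is applied to parts of sizes [a + 1] and [b + 1]. *)
Lemma edge_bound (R : realFieldType) (n a b t q : nat) :
  n = (a + b + t + q + 2)%N -> (12 <= n)%N ->
  a%:R * b%:R + n%:R * (t + q)%:R / 16 <=
  4 * (maxC4 n)%:R / n%:R * ((a + 1 + t)%:R^-1 + (b + 1 + t)%:R^-1) :> R.
Proof.
move=> en n12; have n0 : 0 < n%:R :> R by rewrite ltr0n; lia.
have x0 : 0 < (a + 1 + t)%:R :> R by rewrite ltr0n; lia.
have y0 : 0 < (b + 1 + t)%:R :> R by rewrite ltr0n; lia.
rewrite -(ler_pM2l n0) -(ler_pM2r (mulr_gt0 x0 y0)).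
have -> : n%:R * (4 * (maxC4 n)%:R / n%:R * ((a + 1 + t)%:R^-1 + (b + 1 + t)%:R^-1))
    * ((a + 1 + t)%:R * (b + 1 + t)%:R) =
    4 * (maxC4 n)%:R * (a%:R + b%:R + 2 + 2 * t%:R) :> R.
  by rewrite !natrD; field; rewrite !natrD in x0 y0; rewrite !gt_eqF.
have [tq|tq] := posnP (t + q)%N; last first.
  rewrite !natrD; apply: (@edge_bound_real _ _ _ _ _ q%:R); rewrite ?ler0n //.
  - by rewrite en !natrD.
  - by rewrite -natrD ler1n.
  - by rewrite ler_nat.
  - exact: maxC4_lower.
have t0 : t = 0%N by lia.
have q0 : q = 0%N by lia.
clear x0 y0 tq; subst t q.
have := bin2M_le_maxC4 (a + 1) (b + 1).
have -> : (a + 1 + (b + 1) = n)%N by lia.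
rewrite -(ler_nat R) natrM !natr_bin2 => h.
have nE : n%:R = a%:R + b%:R + 2 :> R by rewrite en !addn0 !natrD.
rewrite !addn0 !natrD in h *; rewrite !mulr0 mul0r !addr0 -nE.
rewrite [leRHS]mulrC -mulrA; apply: ler_wpM2l; first exact: ltW.
move: h; lra.
Qed.

(** * Neighbourhoods at an edge and the deficit inequality *)

Definition nbrs (T : finType) (G : sgraph T) (u : T) : {set T} :=
  [set x | adj G u x]%SET.

Definition private_nbrs (T : finType) (G : sgraph T) (u v : T) : {set T} :=
  [set x | [&& adj G u x, ~~ adj G v x & x != v]]%SET.

Definition common_nbrs (T : finType) (G : sgraph T) (u v : T) : {set T} :=
  [set x | adj G u x && adj G v x]%SET.

Definition agreeing (T : finType) (G : sgraph T) (u v : T) : {set T} :=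
  [set x | adj G u x == adj G v x]%SET.

Definition missing (T : finType) (G : sgraph T) (u v : T) : {set T * T} :=
  [set p in finset.setX (private_nbrs G u v) (private_nbrs G v u) |
   ~~ adj G p.1 p.2]%SET.

(** Ordered pairs: each edge inside the neighbourhood of [u] occurs twice. *)
Definition triangles (T : finType) (G : sgraph T) (u : T) : {set T * T} :=
  [set p | [&& adj G u p.1, adj G u p.2 & adj G p.1 p.2]]%SET.

Lemma card_nbrs (T : finType) (G : sgraph T) u v : adj G u v ->
  #|nbrs G u| = (#|private_nbrs G u v| + 1 + #|common_nbrs G u v|)%N.
Proof.
move=> uv; rewrite (cardsD1 v) inE uv add1n addn1 addSn; congr _.+1.
rewrite -(cardsID (nbrs G v)) addnC; congr addn; apply: eq_card => x.
  by rewrite !inE; case: (adj G u x) (adj G v x) (x == v) => -[] [].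
rewrite !inE; case: (eqVneq x v) => //= ->; by rewrite adjxx andbF.
Qed.

(** The final 2 stands for [u] and [v], which belong to none of the three sets. *)
Lemma card_agreeing (T : finType) (G : sgraph T) u v : adj G u v ->
  #|T| = (#|private_nbrs G u v| + #|private_nbrs G v u| +
          #|agreeing G u v| + 2)%N.
Proof.
move=> uv; have nuv := adj_neq uv.
rewrite -cardsT (cardsD1 u) (cardsD1 v) !inE eq_sym nuv /= addnA addn2 -addn2.
rewrite addnC; congr addn.
rewrite -(cardsID (agreeing G u v)) addnC; congr addn; last first.
  apply: eq_card => x; rewrite !inE andbT.
  case: (eqVneq x v) => [->|]; first by rewrite adjxx uv.
  by case: (eqVneq x u) => [->|]; rewrite ?andbT // adjxx adjC uv.
rewrite -(cardsID (nbrs G u)); congr addn; apply: eq_card => x; rewrite !inE.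
  case: (eqVneq x v) => [->|]; first by rewrite adjxx !andbF.
  case: (eqVneq x u) => [->|]; first by rewrite adjxx !andbF.
  by case: (adj G u x) (adj G v x) => -[].
case: (eqVneq x v) => [->|]; first by rewrite adjxx !andbF.
case: (eqVneq x u) => [->|]; first by rewrite !andbF.
by case: (adj G u x) (adj G v x) => -[].
Qed.

Lemma card_crossing (T : finType) (G : sgraph T) u v :
  (#|crossing G u v| + #|missing G u v| =
   #|private_nbrs G u v| * #|private_nbrs G v u|)%N.
Proof.
rewrite -cardsX -(cardsID [set p | adj G p.1 p.2]%SET); congr addn.
  apply: eq_card => p; rewrite !inE -!andbA.
  by case: (adj G u p.1) (adj G v p.1) (adj G v p.2) (adj G u p.2)
    => -[] [] [] //=; rewrite ?andbF.
by apply: eq_card => p; rewrite !inE andbC.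
Qed.

Lemma C4_edge_bound (R : realFieldType) (T : finType) (G : sgraph T) u v :
  adj G u v -> (12 <= #|T|)%N ->
  #|crossing G u v|%:R +
    (#|missing G u v|%:R + #|T|%:R * #|agreeing G u v|%:R / 16) <=
  4 * (maxC4 #|T|)%:R / #|T|%:R * (#|nbrs G u|%:R^-1 + #|nbrs G v|%:R^-1) :> R.
Proof.
move=> uv n12; rewrite (card_nbrs uv) (@card_nbrs _ _ v u) 1?adjC //.
have -> : common_nbrs G v u = common_nbrs G u v.
  by apply/setP => x; rewrite !inE andbC.
have [q qE] : exists q, #|agreeing G u v| = (#|common_nbrs G u v| + q)%N.
  exists (#|agreeing G u v| - #|common_nbrs G u v|)%N; rewrite subnKC //.
  apply/subset_leq_card/fintype.subsetP => x.
  by rewrite !inE => /andP[-> ->].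
rewrite addrA -natrD card_crossing natrM qE.
by apply: edge_bound => //; rewrite (card_agreeing uv) qE !addnA.
Qed.

Lemma sum_adj_swap (V : nmodType) (T : finType) (G : sgraph T) (F : T -> V) :
  \sum_(p : T * T | adj G p.1 p.2) F p.2 =
  \sum_(p : T * T | adj G p.1 p.2) F p.1.
Proof.
rewrite (reindex_inj (h := fun p : T * T => (p.2, p.1))) /=.
  by apply: eq_bigl => p; rewrite adjC.
by move=> [a b] [c d] /= [-> ->].
Qed.

Lemma sum_adj_fst (V : nmodType) (T : finType) (G : sgraph T) (F : T -> V) :
  \sum_(p : T * T | adj G p.1 p.2) F p.1 = \sum_u F u *+ #|nbrs G u|.
Proof.
rewrite -(pair_big_dep predT (fun u v => adj G u v) (fun u v => F u)) /=.
by apply: eq_bigr => u _; rewrite -sumr_const; apply: eq_bigl => x; rewrite inE.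
Qed.

Lemma C4_deficit (R : realFieldType) (T : finType) (G : sgraph T) :
  (12 <= #|T|)%N ->
  8 * (copies (cycle_graph 4) G)%:R +
  \sum_(p : T * T | adj G p.1 p.2)
     (#|missing G p.1 p.2|%:R + #|T|%:R * #|agreeing G p.1 p.2|%:R / 16) <=
  8 * (maxC4 #|T|)%:R :> R.
Proof.
move=> n12; have n0 : 0 < #|T|%:R :> R by rewrite ltr0n; lia.
set M := (maxC4 _)%:R; set K := 4 * M / #|T|%:R.
have K0 : 0 <= K by rewrite divr_ge0 // mulr_ge0.
apply: (@le_trans _ _ (\sum_(p : T * T | adj G p.1 p.2)
    K * (#|nbrs G p.1|%:R^-1 + #|nbrs G p.2|%:R^-1))).
  apply: (le_trans _ (ler_sum _ (fun p h => C4_edge_bound R h n12))).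
  rewrite [leRHS]big_split /= lerD2r -natr_sum mulrC -natrM ler_nat.
  exact: copies_C4_crossing.
rewrite -mulr_sumr big_split /= (sum_adj_swap G (fun u => #|nbrs G u|%:R^-1)).
rewrite (sum_adj_fst G (fun u => #|nbrs G u|%:R^-1 : R)).
have le_n : \sum_u (#|nbrs G u|%:R^-1 *+ #|nbrs G u|) <= #|T|%:R :> R.
  rewrite -sum1_card natr_sum; apply: ler_sum => u _; rewrite -[leLHS]mulr_natr.
  (* A vertex of positive degree contributes 1 and an isolated one contributes 0. *)
  have [->|d0] := posnP #|nbrs G u|; first by rewrite mulr0 ler01.
  by rewrite mulVf // pnatr_eq0 -lt0n.
have := ler_wpM2l K0 le_n.
have -> : K * #|T|%:R = 4 * M by rewrite /K divfK // gt_eqF.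
lra.
Qed.

(** * Edit number with respect to complete bipartite graphs *)

Lemma edit_number_le (m : nat) (B : sgraph 'I_m) (T : finType) (G : sgraph T)
    (f : T -> 'I_m) :
  (edit_number B G <=
   #|[set p : T * T | adj G p.1 p.2 != adj (blowup B f) p.1 p.2]%SET|)%N.
Proof.
rewrite /edit_number; set H := blowup B f.
have HB : is_blowup B H.
  apply/existsP; exists [ffun x => f x]; apply/eqP; rewrite /H /blowup.
  by congr graph_of_rel; apply/funext => x; apply/funext => y; rewrite !ffunE.
rewrite -minEnat; apply: leq_trans (_ : _ <= _)%N _.
  exact: (@bigmin_le_cond _ nat _ _ H).
(* Every changed edge is the image of an ordered pair; counting both orders costs a harmless factor
   2. *)
apply: leq_trans (leq_imset_card (fun p : T * T => [set p.1; p.2]%SET) _).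
apply/subset_leq_card/fintype.subsetP => e eD.
have [x [y [xy eE]]] : exists x y, x != y /\ e = [set x; y]%SET.
  by move: eD; rewrite finset.in_setU !finset.in_setD => /orP[]/andP[_ h]; exact: edge_set2 h.
apply/imsetP; exists (x, y); rewrite // inE /=.
by move: eD; rewrite eE finset.in_setU !finset.in_setD /adj; case: (_ \in _) (_ \in _) => -[].
Qed.

(** Take a wrong pair with both ends outside [agreeing]. If its ends have equal colours, it is an
    edge inside the neighbourhood of [u] or of [v]; otherwise it is missing, in one of its two
    orders. Pairs meeting [agreeing] are bounded trivially. *)
Lemma edit_number_edge (T : finType) (G : sgraph T) u v : adj G u v ->
  (edit_number (complete_graph 2) G <=
   #|triangles G u| + #|triangles G v| + 2 * (#|T| * #|agreeing G u v|) +
   2 * #|missing G u v|)%N.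
Proof.
move=> uv; pose f x : 'I_2 := if adj G u x then 1 else 0.
apply: leq_trans (edit_number_le _ _ f) _.
set Z := [set p | _]%SET; set Rs := agreeing G u v.
pose sw (p : T * T) := (p.2, p.1).
have -> : (2 * #|missing G u v| = #|missing G u v| + #|sw @: missing G u v|)%N.
  by rewrite card_imset ?mul2n ?addnn // => -[a b] [c d] [-> ->].
have -> : (2 * (#|T| * #|Rs|) = #|finset.setX Rs [set: T]| + #|finset.setX [set: T] Rs|)%N.
  by rewrite !cardsX cardsT mul2n -addnn [X in (_ = X + _)%N]mulnC.
suff sub : Z \subset (triangles G u :|: triangles G v :|:
    (finset.setX Rs [set: T] :|: finset.setX [set: T] Rs) :|:
    (missing G u v :|: sw @: missing G u v))%SET.
  apply: leq_trans (subset_leq_card sub) _.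
  have cU (A B : {set T * T}) : (#|A :|: B| <= #|A| + #|B|)%N.
    by rewrite cardsU leq_subr.
  do 2!(apply: leq_trans (cU _ _) _; rewrite ?leq_add //).
apply/fintype.subsetP => -[x y]; rewrite !finset.in_setU.
have -> : ((x, y) \in sw @: missing G u v)%SET = ((y, x) \in missing G u v).
  by rewrite -[(x, y)]/(sw (y, x)) mem_imset // => -[a b] [c d] [-> ->].
rewrite !inE adj_blowup_K2 /= -!andbA.
have -> : (f x != f y) = (adj G u x != adj G u y).
  by rewrite /f; case: (adj G u x) (adj G u y) => -[].
rewrite [adj G y x]adjC.
(* [missing] leaves out pairs containing [u] or [v]. These implications determine adjacency there,
   which lets the Boolean case analysis close. *)
have xv : (x == v) ==> (adj G x y == adj G v y) by apply/implyP => /eqP->.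
have xu : (x == u) ==> (adj G x y == adj G u y) by apply/implyP => /eqP->.
have yv : (y == v) ==> (adj G x y == adj G v x).
  by apply/implyP => /eqP->; rewrite adjC.
have yu : (y == u) ==> (adj G x y == adj G u x).
  by apply/implyP => /eqP->; rewrite adjC.
move: xv xu yv yu; move: (x == v) (x == u) (y == v) (y == u) (adj G x y)
  (adj G u x) (adj G u y) (adj G v x) (adj G v y).
by do 9!case.
Qed.

(** Fixing the first vertex [x] of a triangle at [u] leaves the common neighbours of [u] and [x],
    all of them agreeing. The factor [#|T|] bounds the degree of [u], which is how often its
    triangles are counted. *)
Lemma sum_triangles (T : finType) (G : sgraph T) :
  (\sum_(p : T * T | adj G p.1 p.2) #|triangles G p.1| <=
   #|T| * \sum_(p : T * T | adj G p.1 p.2) #|agreeing G p.1 p.2|)%N.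
Proof.
have -> : (\sum_(p : T * T | adj G p.1 p.2) #|triangles G p.1| =
    \sum_u #|triangles G u| * #|nbrs G u|)%N.
  rewrite -(pair_big_dep predT (fun u v => adj G u v)
    (fun u v => #|triangles G u|)) /=.
  apply: eq_bigr => u _; rewrite mulnC -sum_nat_const.
  by apply: eq_bigl => x; rewrite inE.
rewrite -(pair_big_dep predT (fun u v => adj G u v)
  (fun u v => #|agreeing G u v|)) /= big_distrr /=.
apply: leq_sum => u _; rewrite mulnC; apply: leq_mul; first exact: max_card.
rewrite -sum1dep_card -(pair_big_dep (fun x => adj G u x)
  (fun x y => adj G u y && adj G x y) (fun _ _ => 1%N)) /=.
apply: leq_sum => x ux; rewrite sum1dep_card.
apply/subset_leq_card/fintype.subsetP => y.
by rewrite !inE => /andP[-> ->].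
Qed.

(** The coefficient 4 is 2 from [edit_number_edge] plus 1 from each of the two triangle sums, which
    are equal by symmetry. *)
Lemma edit_number_sum (T : finType) (G : sgraph T) :
  (#|[pred p : T * T | adj G p.1 p.2]| * edit_number (complete_graph 2) G <=
   4 * (#|T| * \sum_(p : T * T | adj G p.1 p.2) #|agreeing G p.1 p.2|) +
   2 * \sum_(p : T * T | adj G p.1 p.2) #|missing G p.1 p.2|)%N.
Proof.
rewrite -sum_nat_const (eq_bigl (fun p : T * T => adj G p.1 p.2)) //.
apply: (@leq_trans (\sum_(p : T * T | adj G p.1 p.2)
    (#|triangles G p.1| + #|triangles G p.2| +
     2 * (#|T| * #|agreeing G p.1 p.2|) + 2 * #|missing G p.1 p.2|))%N).
  by apply: leq_sum => p; exact: edit_number_edge.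
have sw : (\sum_(p : T * T | adj G p.1 p.2) #|triangles G p.2| =
    \sum_(p : T * T | adj G p.1 p.2) #|triangles G p.1|)%N.
  exact: (sum_adj_swap G (fun u => #|triangles G u|)).
set t := (\sum_(p | _) #|triangles _ p.2|)%N in sw *.
set t' := (\sum_(p | _) #|triangles _ p.1|)%N in sw.
set a := (\sum_(p | _) #|agreeing _ _ _|)%N.
set m := (\sum_(p | _) #|missing _ _ _|)%N.
have -> : (\sum_(p : T * T | adj G p.1 p.2)
    (#|triangles G p.1| + #|triangles G p.2| +
     2 * (#|T| * #|agreeing G p.1 p.2|) + 2 * #|missing G p.1 p.2|) =
    t' + t + 2 * (#|T| * a) + 2 * m)%N.
  by rewrite /t /t' /a /m !big_distrr /= -!big_split.
have := sum_triangles G; rewrite -/a -/t' sw.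
move: t t' a m {sw} #|T| => t t' a m N; lia.
Qed.

(** Each edge has at most [a * b <= n^2 / 4] crossing pairs. This disposes of sparse graphs, where
    averaging over edges gives too little. *)
Lemma C4_few_edges (T : finType) (G : sgraph T) :
  (32 * copies (cycle_graph 4) G <=
   #|[pred p : T * T | adj G p.1 p.2]| * #|T| ^ 2)%N.
Proof.
have := copies_C4_crossing G.
suff : (4 * \sum_(p : T * T | adj G p.1 p.2) #|crossing G p.1 p.2| <=
    #|[pred p : T * T | adj G p.1 p.2]| * #|T| ^ 2)%N by lia.
rewrite -sum_nat_const (eq_bigl (fun p : T * T => adj G p.1 p.2)) //.
rewrite big_distrr /=; apply: leq_sum => p uv.
have := card_crossing G p.1 p.2; have := card_agreeing uv.
move: #|crossing _ _ _| #|missing _ _ _| #|private_nbrs _ _ _|.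
move: #|private_nbrs _ _ _| #|agreeing _ _ _| => b r c m a -> e.
have h : (c <= a * b)%N by lia.
apply: (@leq_trans (4 * (a * b))%N); first by rewrite leq_mul2l.
apply: leq_trans (nat_AGM2 a b) _.
by rewrite leq_sqr; lia.
Qed.

Lemma edit_number_le_default (m : nat) (B : sgraph 'I_m) (T : finType)
    (G : sgraph T) : (edit_number B G <= 'C(#|T|, 2))%N.
Proof.
by apply: (big_rec (fun k => (k <= 'C(#|T|, 2))%N)) => // H k _; apply: leq_trans; exact: geq_minr.
Qed.

Lemma C4_edit_stability (R : realFieldType) (T : finType) (G : sgraph T) :
  (12 <= #|T|)%N ->
  (edit_number (complete_graph 2) G)%:R * #|T|%:R ^+ 2 <=
  4096 * ((maxC4 #|T|)%:R - (copies (cycle_graph 4) G)%:R) :> R.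
Proof.
move=> n12; have := C4_deficit R G n12; rewrite big_split /= -natr_sum.
rewrite -mulr_suml -mulr_sumr -natr_sum.
set a := (\sum_(p | _) #|agreeing _ _ _|)%N.
set b := (\sum_(p | _) #|missing _ _ _|)%N.
have hM := maxC4_lower R #|T|.
have nge : 12 <= #|T|%:R :> R by rewrite ler_nat.
set m := #|[pred p : T * T | adj G p.1 p.2]|.
set e := edit_number (complete_graph 2) G.
have hP : 32 * (copies (cycle_graph 4) G)%:R <= m%:R * #|T|%:R ^+ 2 :> R.
  by rewrite -natrX -!natrM ler_nat; exact: C4_few_edges.
have hS : m%:R * e%:R <= 4 * (#|T|%:R * a%:R) + 2 * b%:R :> R.
  by rewrite -!natrM -natrD ler_nat; exact: edit_number_sum.
have en : e%:R <= #|T|%:R ^+ 2 :> R.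
  rewrite -natrX ler_nat; apply: leq_trans (edit_number_le_default _ _) _.
  by have := bin2_double #|T|; rewrite expnS expn1; nia.
have e0 : 0 <= e%:R :> R by rewrite ler0n.
have b0 : 0 <= b%:R :> R by rewrite ler0n.
move: (copies _ _)%:R (maxC4 _)%:R {n12} m%:R e%:R #|T|%:R a%:R b%:R
  hM nge hP hS en e0 b0 => P M {}m {}e n {}a {}b hM nge hP hS en e0 b0 hD.
have n20 : 0 <= n ^+ 2 by exact: sqr_ge0.
(* Dense case: [m * e] is at most 64 times the sum bounded in [hD], hence at most 512 (M - P), and
   [n ^+ 2 <= 8 * m] turns this into 4096. *)
have [hm|hm] := leP (n ^+ 2) (8 * m).
  have := ler_wpM2l e0 hm; lra.
(* Sparse case: P <= n^4 / 256 while M >= n^4 / 96, so the deficit is of order n^4 and the trivial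
   bound [en] suffices. *)
have h1 : m * n ^+ 2 <= n ^+ 2 / 8 * n ^+ 2 by apply: ler_wpM2r => //; lra.
have h2 : e * n ^+ 2 <= n ^+ 2 * n ^+ 2 by exact: ler_wpM2r.
have n30 : 0 <= n ^+ 3 by apply: exprn_ge0; lra.
have h3 : n ^+ 3 * (2 / 3 * n) <= n ^+ 3 * (n - 4) by apply: ler_wpM2l => //; lra.
have h4 : 0 <= n ^+ 2 * n ^+ 2 by exact: mulr_ge0.
lra.
Qed.

(** * The maximum density and perfect stability *)

Lemma natr_bin4 (R : realFieldType) (x : nat) :
  'C(x, 4)%:R = x%:R * (x%:R - 1) * (x%:R - 2) * (x%:R - 3) / 24 :> R.
Proof.
apply: (@mulIf _ 24); first by rewrite pnatr_eq0.
rewrite -[LHS]natrM (bin_ffact x 4) divfK ?pnatr_eq0 //.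
case: x => [|[|[|[|x]]]]; rewrite ?mul0r ?subrr ?mulr0 ?mul0r //.
rewrite !ffactnS ffactn0 /= !natrM.
by rewrite -(natr1 x.+3) -(natr1 x.+2) -(natr1 x.+1) -(natr1 x); ring.
Qed.

Lemma lambda_C4 (R : realType) (T : finType) (G : sgraph T) :
  lambda (C4_inducibility R) G =
  (copies (cycle_graph 4) G)%:R / 'C(#|T|, 4)%:R.
Proof. by rewrite /lambda Lambda_C4. Qed.

Lemma lambda_max_ge (R : realType) (n : nat) (G : sgraph 'I_n) :
  lambda (C4_inducibility R) G <= lambda_max (C4_inducibility R) n.
Proof.
rewrite /lambda_max; case: pickP => [G0 G0P|/(_ G)]; last first.
  by rewrite admissible_C4.
by case: arg_maxP => // H _; apply; exact: admissible_C4.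
Qed.

Lemma lambda_max_attained (R : realType) (n : nat) :
  exists G : sgraph 'I_n,
    lambda_max (C4_inducibility R) n = lambda (C4_inducibility R) G.
Proof.
rewrite /lambda_max; case: pickP => [G0 G0P|]; first by eexists.
by move/(_ (graph_of_rel (fun _ _ => false))); rewrite admissible_C4.
Qed.

Lemma copies_balanced (n : nat) :
  exists G : sgraph 'I_n, copies (cycle_graph 4) G = maxC4 n.
Proof.
pose f (i : 'I_n) : 'I_2 := if (i < n./2)%N then 0 else 1.
exists (blowup (complete_graph 2) f); rewrite copies_C4_K2.
have c0 : #|[set x | f x == 0]%SET| = n./2.
  rewrite -sum1dep_card (eq_bigl (fun i : 'I_n => (i < n./2)%N)); last first.
    by move=> i; rewrite /f; case: ifP.
  by rewrite -(big_ord_widen n (fun _ => 1%N)) ?sum1_card ?card_ord; lia.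
have c1 : #|[set x | f x == 1]%SET| = uphalf n.
  have := cardsC [set x | f x == 0]%SET; rewrite c0 card_ord.
  have -> : (~: [set x | f x == 0])%SET = [set x | f x == 1]%SET.
    by apply/setP => x; rewrite !inE; case: (f x) => [[|[|?]] ?].
  lia.
rewrite big_ord_recl big_ord1.
have -> : lift ord0 ord0 = 1 :> 'I_2 by exact: val_inj.
by rewrite c0 c1.
Qed.

(** The left-hand side of [C4_edit_stability] is nonnegative, so the extremal bound follows from
    it. *)
Lemma copies_C4_le_max (T : finType) (G : sgraph T) : (12 <= #|T|)%N ->
  (copies (cycle_graph 4) G <= maxC4 #|T|)%N.
Proof.
move=> n12; rewrite -(ler_nat rat); have := C4_edit_stability rat G n12.
have : 0 <= (edit_number (complete_graph 2) G)%:R * #|T|%:R ^+ 2 :> rat.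
  by rewrite mulr_ge0 // exprn_ge0.
move: (_ * _) (copies _ _)%:R (maxC4 _)%:R => x y z; lra.
Qed.

Lemma lambda_max_C4 (R : realType) (n : nat) : (12 <= n)%N ->
  lambda_max (C4_inducibility R) n = (maxC4 n)%:R / 'C(n, 4)%:R.
Proof.
move=> n12; apply/eqP; rewrite eq_le; apply/andP; split.
  have [G ->] := lambda_max_attained R n; rewrite lambda_C4 card_ord.
  rewrite ler_wpM2r ?invr_ge0 // ler_nat -[in leqRHS](card_ord n).
  by apply: copies_C4_le_max; rewrite card_ord.
have [G <-] := copies_balanced n.
by apply: le_trans (lambda_max_ge R G); rewrite lambda_C4 card_ord.
Qed.

Lemma C4_perfectly_stable (R : realType) :
  perfectly_stable (C4_inducibility R) (complete_graph 2).
Proof.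
(* The factor comes from [C4_edit_stability]; as a threshold on the order it also yields
   [12 <= n]. *)
exists 4096; split; first by rewrite ltr0n.
move=> n G nge _.
have n12 : (12 <= n)%N by rewrite -(ler_nat R); apply: le_trans nge; rewrite ler_nat.
rewrite lambda_max_C4 // lambda_C4 /edit_distance card_ord -mulrBl.
have c2 : 0 < 'C(n, 2)%:R :> R by rewrite ltr0n bin_gt0; lia.
have c4 : 0 < 'C(n, 4)%:R :> R by rewrite ltr0n bin_gt0; lia.
rewrite ler_pdivrMr // mulrA mulrAC ler_pdivlMr //.
have := @C4_edit_stability R _ G; rewrite card_ord => /(_ n12).
have e0 : 0 <= (edit_number (complete_graph 2) G)%:R :> R by rewrite ler0n.
have : 12 <= n%:R :> R by rewrite ler_nat.
rewrite natr_bin2 natr_bin4; move: (edit_number _ _)%:R (copies _ _)%:R e0.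
move: n%:R (maxC4 n)%:R => N M e P e0 N12.
(* The normalisations are compared through n^4 / 24: ['C(n, 4)] lies below it, and n^2 / 24 lies
   below ['C(n, 2)]. *)
have h1 : e * (N * (N - 1) * (N - 2) * (N - 3) / 24) <= e * N ^+ 2 * (N ^+ 2 / 24).
  rewrite -[leRHS]mulrA; apply: ler_wpM2l => //.
  suff : N * (N - 1) * (N - 2) * (N - 3) <= N ^+ 2 * N ^+ 2 by lra.
  rewrite -[leLHS]mulrA !expr2; apply: ler_pM.
  - by apply: mulr_ge0; lra.
  - by apply: mulr_ge0; lra.
  - by apply: ler_wpM2l; lra.
  - by lra.
have h2 : 0 <= N ^+ 2 / 24 by rewrite divr_ge0 ?sqr_ge0.
have h3 : N ^+ 2 / 24 <= N * (N - 1) / 2.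
  have h : 12 * N <= N * N by apply: ler_wpM2r; lra.
  by clear -h N12; lra.
move=> h; apply: (le_trans h1).
have D0 : 0 <= 4096 * (M - P).
  by apply: le_trans h; apply: mulr_ge0 => //; exact: sqr_ge0.
apply: (@le_trans _ _ (4096 * (M - P) * (N ^+ 2 / 24))).
  exact: ler_wpM2r.
exact: ler_wpM2l.
Qed.

(** * Limit densities of blow-ups *)

Lemma cvg_ratio (R : realType) (s : nat -> nat) (a K : R) :
  (forall n, `|(s n)%:R - a * n%:R| <= K) ->
  ((s n)%:R / n%:R @[n --> \oo] --> a)%classic.
Proof.
move=> h; apply/cvgrPdist_le => e e0; near=> n.
have n0 : 0 < n%:R :> R by rewrite ltr0n; near: n; exact: nbhs_infty_gt.
have -> : a - (s n)%:R / n%:R = - ((s n)%:R - a * n%:R) / n%:R.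
  by field; rewrite gt_eqF.
rewrite normrM normrN normfV (gtr0_norm n0) ler_pdivrMr //.
apply: le_trans (h n) _; rewrite mulrC -ler_pdivrMr //.
near: n; exact: nbhs_infty_ger.
Unshelve. all: end_near.
Qed.

Lemma cvg_C4_density (R : realType) (s t : nat -> nat) (a b K : R) :
  a + b = 1 ->
  (forall n, `|(s n)%:R - a * n%:R| <= K) ->
  (forall n, `|(t n)%:R - b * n%:R| <= K) ->
  (('C(s n, 2) * 'C(t n, 2))%:R / 'C(s n + t n, 4)%:R @[n --> \oo] -->
   6 * (a ^+ 2 * b ^+ 2))%classic.
Proof.
move=> ab hs ht; have xs := cvg_ratio hs; have xt := cvg_ratio ht.
have inv0 : ((n%:R : R)^-1 @[n --> \oo] --> (0 : R))%classic.
  have -> : (fun n : nat => n%:R^-1) = (fun n : nat => 1%:R / n%:R) :> (nat -> R).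
    by apply/funext => n; rewrite mul1r.
  apply: (@cvg_ratio R (fun _ => 1%N) 0 1) => n.
  by rewrite mul0r subr0 normr1.
pose x n : R := (s n)%:R / n%:R; pose y n : R := (t n)%:R / n%:R.
pose i n : R := n%:R^-1.
(* Numerator and denominator divided by n^4, as a rational expression in [x], [y] and [i], which
   tend to [a], [b] and 0. *)
pose F n : R := (x n * (x n - i n) / 2) * (y n * (y n - i n) / 2) /
  ((x n + y n) * (x n + y n - i n) * (x n + y n - 2 * i n) *
   (x n + y n - 3 * i n) / 24).
have FE : (\forall n \near \oo,
    F n = ('C(s n, 2) * 'C(t n, 2))%:R / 'C(s n + t n, 4)%:R)%classic.
  near=> n; have n0 : 0 < n%:R :> R.
    by rewrite ltr0n; near: n; exact: nbhs_infty_gt.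
  rewrite natrM !natr_bin2 natr_bin4 natrD /F /x /y /i.
  set S : R := (s n)%:R; set T : R := (t n)%:R; set N : R := n%:R in n0 *.
  have nN : N != 0 by rewrite gt_eqF.
  have -> : (S / N + T / N) * (S / N + T / N - N^-1) *
      (S / N + T / N - 2 * N^-1) * (S / N + T / N - 3 * N^-1) / 24 =
      N^-1 ^+ 4 * ((S + T) * (S + T - 1) * (S + T - 2) * (S + T - 3) / 24).
    by field.
  (* The inverse of [D] is kept opaque, so the identity needs no proof that [D] is nonzero. *)
  move: ((S + T) * (S + T - 1) * _ * _ / 24) => D.
  rewrite [(N^-1 ^+ 4 * _)^-1]invfM.
  by move: D^-1 => {}D; field.
have Flim : (F n @[n --> \oo] --> (a * (a - 0) / 2) * (b * (b - 0) / 2) /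
    ((a + b) * (a + b - 0) * (a + b - 2 * 0) * (a + b - 3 * 0) / 24))%classic.
  have sub (c : R) : (x n + y n - c * i n @[n --> \oo] --> a + b - c * 0)%classic.
    by apply: cvgB; [exact: cvgD|exact: (cvgM (cvg_cst _))].
  apply: cvgM; first apply: cvgM.
  - apply: (cvgM _ (cvg_cst _)); apply: cvgM => //; exact: cvgB.
  - apply: (cvgM _ (cvg_cst _)); apply: cvgM => //; exact: cvgB.
  apply: cvgV; first by rewrite ab; lra.
  apply: (cvgM _ (cvg_cst _)); apply: cvgM => //; apply: cvgM => //.
  apply: cvgM; first exact: cvgD.
  by apply: cvgB => //; exact: cvgD.
have -> : 6 * (a ^+ 2 * b ^+ 2) = (a * (a - 0) / 2) * (b * (b - 0) / 2) /
    ((a + b) * (a + b - 0) * (a + b - 2 * 0) * (a + b - 3 * 0) / 24).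
  by rewrite ab; field.
exact: cvg_trans (near_eq_cvg FE) Flim.
Unshelve. all: end_near.
Qed.

Lemma lambda_blowup_sizes (R : realType) (s : 'I_2 -> nat) :
  lambda (C4_inducibility R) (blowup_sizes (complete_graph 2) s) =
  ('C(s 0, 2) * 'C(s 1, 2))%:R / 'C(s 0 + s 1, 4)%:R.
Proof.
have e : lift ord0 ord0 = 1 :> 'I_2 by exact: val_inj.
rewrite lambda_C4 copies_C4_K2 big_ord_recl big_ord1 e.
have cc c : #|[set x : {i : 'I_2 & 'I_(s i)} | tag x == c]%SET| = s c.
  have inj : injective (fun u : 'I_(s c) => Tagged (fun i => 'I_(s i)) u).
    by move=> u v /eqP; rewrite eq_Tagged => /eqP.
  rewrite -[RHS]card_ord -cardsT -(card_imset _ inj).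
  apply: eq_card => -[j u]; rewrite inE /=; apply/eqP/imsetP.
    by move=> jc; subst j; exists u; rewrite ?finset.in_setT.
  by move=> [v _ h]; exact: (congr1 tag h).
rewrite !cc card_tagged sumnE big_map big_enum big_ord_recl big_ord1 e.
by rewrite !card_ord.
Qed.

Lemma sum_simplex2 (R : realType) (a : 'rV[R]_2) : simplex a ->
  a 0 0 + a 0 1 = 1.
Proof.
move=> [_]; rewrite big_ord_recl big_ord1.
by have -> : lift ord0 ord0 = 1 :> 'I_2 by exact: val_inj.
Qed.

Lemma is_lambda_blowup_K2 (R : realType) (a : 'rV[R]_2) : simplex a ->
  is_lambda_blowup (C4_inducibility R) (complete_graph 2) a
    (6 * (a 0 0 ^+ 2 * a 0 1 ^+ 2)).
Proof.
move=> sa s [K hK].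
have := cvg_C4_density (sum_simplex2 sa) (fun n => hK n 0) (fun n => hK n 1).
by under eq_cvg do rewrite -lambda_blowup_sizes.
Qed.

Lemma lambda_blowup_K2 (R : realType) (a : 'rV[R]_2) : simplex a ->
  lambda_blowup (C4_inducibility R) (complete_graph 2) a =
  6 * (a 0 0 ^+ 2 * a 0 1 ^+ 2).
Proof.
move=> sa; have h := is_lambda_blowup_K2 sa.
have g := getPex (ex_intro _ _ h).
(* Uniqueness of limits identifies the value chosen by [get] once some admissible size sequence
   exists; rounding down errs by at most 1. *)
pose s n i := Num.truncn (a 0 i * n%:R).
have sP : exists K : R, forall n i, `|(s n i)%:R - a 0 i * n%:R| <= K.
  exists 1 => n i; have a0 : 0 <= a 0 i * n%:R by rewrite mulr_ge0 // sa.1.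
  have := truncn_itv a0; rewrite -/(s n i) -natr1 => /andP[h1 h2].
  by rewrite ler_norml; apply/andP; split; lra.
exact: (cvg_unique (@Rhausdorff R) (g s sP) (h s sP)).
Qed.

Theorem theorem1p4 (R : realType) :
  let Q := C4_inducibility R in
  let B := complete_graph 2 in
  [/\ perfectly_stable Q B,
      (lambda_max Q n @[n --> \oo] --> (3 / 8 : R))%classic,
      (* the limit defining lambda(B(a)) exists *)
      (forall a : 'rV[R]_2, simplex a ->
         is_lambda_blowup Q B a (lambda_blowup Q B a))
    & (forall a : 'rV[R]_2, is_maximiser Q B a <-> a = const_mx (1 / 2))].
Proof.
move=> Q B; split.
- exact: C4_perfectly_stable.
- have half : 1 / 2 + 1 / 2 = 1 :> R by lra.
  have nE n : n%:R = (odd n)%:R + n./2%:R * 2 :> R.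
    by rewrite -natrM -natrD muln2 odd_double_half.
  have odd01 n : 0 <= (odd n)%:R :> R /\ (odd n)%:R <= 1 :> R.
    by rewrite ler0n lern1 leq_b1.
  have h0 n : `|(n./2)%:R - 1 / 2 * n%:R| <= 1 :> R.
    by rewrite [in X in _ * X]nE; have [] := odd01 n; rewrite ler_norml; lra.
  have h1 n : `|(uphalf n)%:R - 1 / 2 * n%:R| <= 1 :> R.
    rewrite uphalf_half natrD [in X in _ * X]nE.
    by have [] := odd01 n; rewrite ler_norml; lra.
  have := cvg_C4_density half h0 h1.
  have -> : 6 * ((1 / 2) ^+ 2 * (1 / 2) ^+ 2) = 3 / 8 :> R by field.
  apply: cvg_trans; apply: near_eq_cvg; near=> n.
  rewrite lambda_max_C4; last by near: n; exact: nbhs_infty_ge.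
  by rewrite /maxC4 uphalf_half addnCA addnn odd_double_half.
- by move=> a sa; rewrite lambda_blowup_K2 //; exact: is_lambda_blowup_K2.
- have sh : simplex (const_mx (1 / 2) : 'rV[R]_2).
    split=> [i|]; first by rewrite mxE; lra.
    by rewrite big_ord_recl big_ord1 !mxE; lra.
  move=> a; split=> [[sa /(_ _ sh)]|->].
    rewrite !lambda_blowup_K2 // !mxE => le.
    have e := sum_simplex2 sa.
    (* The value is 6 (xy)^2 with x + y = 1, so comparison with (1/2, 1/2) gives xy >= 1/4, that is,
       (x - 1/2)^2 <= 0. *)
    have p0 : 0 <= a 0 0 * a 0 1 by apply: mulr_ge0; exact: sa.1.
    have p1 : 1 / 4 <= a 0 0 * a 0 1.
      by rewrite -(@ler_pXn2r _ 2) ?nnegrE //; lra.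
    have a1E : a 0 1 = 1 - a 0 0 by lra.
    have a0E : a 0 0 = 1 / 2.
      have : (a 0 0 - 1 / 2) ^+ 2 <= 0.
        by rewrite a1E in p1; lra.
      rewrite le_eqVlt ltNge sqr_ge0 orbF sqrf_eq0 subr_eq0.
      by move/eqP.
    apply/rowP => i; rewrite mxE.
    case: i => [[|[|?]] hi] //.
      by rewrite -a0E; congr (a _ _); exact: val_inj.
    transitivity (a 0 1); last by lra.
    by congr (a _ _); exact: val_inj.
  split=> // b sb; rewrite !lambda_blowup_K2 // !mxE.
  have e := sum_simplex2 sb.
  have p0 : 0 <= b 0 0 * b 0 1 by apply: mulr_ge0; exact: sb.1.
  have p1 : b 0 0 * b 0 1 <= 1 / 4.
    have -> : b 0 1 = 1 - b 0 0 by lra.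
    by have := sqr_ge0 (b 0 0 - 1 / 2); lra.
  have : (b 0 0 * b 0 1) ^+ 2 <= (1 / 4) ^+ 2.
    by rewrite ler_pXn2r ?nnegrE //; lra.
  by rewrite exprMn; lra.
Unshelve. all: end_near.
Qed.
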